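(* Let $n\ge 1$, let $1\le i<j\le n+1$ and let $w\in S_{n+1}$. Then $$\partial_{ij}\mathfrak{S}_w\in\mathbf{N}[x_1,\ldots,x_{n+1}],$$ i.e. $\partial_{ij}\mathfrak{S}_w$ is a polynomial in $x_1,\ldots,x_{n+1}$ with nonnegative integer coefficients.
   Context: $S_m$ is the symmetric group on $\{1,\dots,m\}$, with product $(vw)(k)=v(w(k))$. Here $\mathbf{N}=\{0,1,2,\dots\}$. For $1\le i<j\le m$ the divided difference operator $\partial_{ij}$ on $\mathbf{Z}[x_1,\dots,x_m]$ is $$\partial_{ij}f=\frac{f-t_{ij}f}{x_i-x_j},$$ where $t_{ij}f$ is obtained from $f$ by interchanging $x_i$ and $x_j$. Write $\partial_i=\partial_{i,i+1}$ for $1\le i\le m-1$. For $u\in S_m$ put $\partial_u=\partial_{a_1}\cdots\partial_{a_p}$, where $u=s_{a_1}\cdots s_{a_p}$ is any reduced decomposition ($s_a=(a,a+1)$, $p=l(u)$ the length of $u$); this does not depend on the choice of the reduced decomposition. For $w\in S_m$ the Schubert polynomial is $\mathfrak{S}_w=\partial_{w^{-1}w_0}(x_1^{m-1}x_2^{m-2}\cdots x_{m-1})$, where $w_0$ is the longest element of $S_m$. In the claim, $m=n+1$. *)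

(* Defs.v *)
(* Indices are 0-based: the variable x_k is 'X_i for the i of value k-1. *)
From mathcomp Require Import all_boot all_order all_fingroup all_algebra.
From mathcomp Require Import zify.
From mathcomp Require Export mpoly.

Set Implicit Arguments.
Unset Strict Implicit.
Unset Printing Implicit Defensive.

Import Order.TTheory GRing.Theory Num.Theory.
Local Open Scope ring_scope.

Section DividedDifference.
Variables (m : nat) (i j : 'I_m).
Implicit Types f g : {mpoly int[m]}.

Lemma divdiff_ex f :
  exists g, f - msym (tperm i j) f == ('X_i - 'X_j) * g.
Proof.
pose P f := exists g, f - msym (tperm i j) f == ('X_i - 'X_j) * g.
have PM h1 h2 : P h1 -> P h2 -> P (h1 * h2).
  move=> [g1 /eqP e1] [g2 /eqP e2]; exists (g1 * h2 + msym (tperm i j) h1 * g2).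
  rewrite mulrDr mulrA -e1 mulrCA -e2 msymM.
  by rewrite mulrBl mulrBr addrA addrNK.
have P1 : P 1 by exists 0; rewrite msym1 subrr mulr0.
have PX k : P 'X_k.
  have -> : P 'X_k = (exists g, 'X_k - 'X_(tperm i j k) == ('X_i - 'X_j) * g).
    by rewrite /P /msym mmapX mmap1U.
  case: tpermP => [->|->|_ _].
  - by exists 1; rewrite mulr1.
  - by exists (-1); rewrite mulrN1 opprB.
  - by exists 0; rewrite subrr mulr0.
have PXm mon : P 'X_[mon].
  rewrite mpolyXE_id; apply: big_ind => // k _.
  elim: (mon k) => [|d IH]; first by rewrite expr0.
  by rewrite exprS; apply: PM.
elim/mpolyind: f => [|c mon p _ _ [gp /eqP ep]].
  by exists 0; rewrite msym0 subrr mulr0.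
have [gm /eqP em] := PXm mon.
exists (c *: gm + gp); apply/eqP.
by rewrite mulrDr -scalerAr -em -ep msymD msymZ scalerBr opprD addrACA.
Qed.

(* The quotient (f - t_ij f) / (x_i - x_j): for i != j it is the unique g in
   Z[x] below (see divdiff_uniq); for i = j the value is a meaningless choice. *)
Definition divdiff f : {mpoly int[m]} := xchoose (divdiff_ex f).

Lemma divdiffE f : ('X_i - 'X_j) * divdiff f = f - msym (tperm i j) f.
Proof. by rewrite -(eqP (xchooseP (divdiff_ex f))). Qed.

Lemma divdiff_uniq f g : i != j ->
  ('X_i - 'X_j) * g = f - msym (tperm i j) f -> g = divdiff f.
Proof.
move=> ne_ij; rewrite -divdiffE; apply: mulfI.
apply/eqP => /(congr1 (mcoeff U_(i))).
by rewrite mcoeff0 mcoeffB !mcoeffX eqxx eq_mnm1 eq_sym (negPf ne_ij) subr0.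
Qed.

End DividedDifference.

Section SymmetricGroup.
Variable n : nat.
Implicit Types u v w : 'S_n.+1.

(* The product of permutations in mathcomp is (v * w) k = w (v k); [compp]
   is the opposite convention (v w)(k) = v (w (k)). *)
Definition compp v w : 'S_n.+1 := (w * v)%g.

Lemma comppE v w k : compp v w k = v (w k).
Proof. by rewrite permM. Qed.

Definition sl (a : 'I_n) : 'I_n.+1 := widen_ord (leqnSn n) a.
Definition sr (a : 'I_n) : 'I_n.+1 := lift ord0 a.

Definition simple (a : 'I_n) : 'S_n.+1 := tperm (sl a) (sr a).

Definition inversions u : {set 'I_n.+1 * 'I_n.+1} :=
  [set p : 'I_n.+1 * 'I_n.+1 | (p.1 < p.2)%N && (u p.2 < u p.1)%N].

Definition plength u : nat := #|inversions u|.

Definition word_perm (a : seq 'I_n) : 'S_n.+1 :=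
  foldr (fun b u => compp (simple b) u) 1%g a.

Definition reduced (u : 'S_n.+1) (a : seq 'I_n) : bool :=
  (word_perm a == u) && (size a == plength u).

Lemma nodescent u : (forall a : 'I_n, (u (sl a) < u (sr a))%N) -> u = 1%g.
Proof.
move=> H.
have mono (k : nat) (hk : (k < n.+1)%N) : (k <= u (Ordinal hk))%N.
  elim: k hk => // k IH hk.
  have hk' : (k < n)%N by [].
  have -> : Ordinal hk = sr (Ordinal hk') by apply: val_inj; rewrite /= /bump add1n.
  apply: leq_ltn_trans (H _); have := IH (ltnW hk).
  by congr (_ <= nat_of_ord (u _))%N; apply: val_inj.
have mono' (i : 'I_n.+1) : (i <= u i)%N.
  by have := mono i (ltn_ord i); congr (_ <= nat_of_ord (u _))%N; apply: val_inj.
have lei : forall i : 'I_n.+1, true -> (i <= u i ?= iff (i == u i :> nat))%N.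
  by move=> i _; split.
have [_] := leqif_sum lei.
rewrite (reindex_inj (@perm_inj _ u)) /= eqxx => /esym/forallP E.
by apply/permP => i; rewrite perm1; have /eqP e := E i; apply: val_inj.
Qed.

Lemma simpleP (a : 'I_n) (k : 'I_n.+1) :
  nat_of_ord (simple a k) =
    if k == a :> nat then a.+1 else if k == a.+1 :> nat then a : nat else k.
Proof.
rewrite /simple; case: tpermP => [->|->|/eqP h1 /eqP h2] /=.
- by rewrite eqxx /bump.
- by rewrite /bump /= add1n eqn_leq ltnn andFb eqxx.
- move: h1 h2; rewrite -!val_eqE /= /bump /= add1n.
  by move=> /negPf -> /negPf ->.
Qed.

Lemma swap_ltn (p q b : nat) : ~~ ((p == b) && (q == b.+1)) -> p != q ->
  ~~ ((p == b.+1) && (q == b)) &&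
  ((if p == b then b.+1 else if p == b.+1 then b else p) <
   (if q == b then b.+1 else if q == b.+1 then b else q))%N = (p < q)%N.
Proof.
by case: (p =P b) => ?; case: (q =P b) => ?; case: (p =P b.+1) => ?;
  case: (q =P b.+1) => ? /=; lia.
Qed.

Lemma plength_descent u (a : 'I_n) : (u (sr a) < u (sl a))%N ->
  plength u = (plength (compp u (simple a))).+1.
Proof.
move=> hd; rewrite /plength.
have slr : (sl a, sr a) \in inversions u by rewrite inE /= hd /bump /= ltnS leqnn.
rewrite (cardsD1 (sl a, sr a)) slr add1n; congr _.+1.
pose s := simple a; pose f (p : 'I_n.+1 * 'I_n.+1) := (s p.1, s p.2).
have sK : involutive s by move=> x; rewrite /s tpermK.
have fK : involutive f by move=> [x y]; rewrite /f /= !sK.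
rewrite -(card_imset _ (inv_inj fK)); apply: eq_card => p.
rewrite -{1}[p]fK (mem_imset _ _ (inv_inj fK)).
case: p => [x y]; rewrite !inE /f /= !comppE -/s xpair_eqE.
have sl_s z : (s z == sl a) = (z == sr a).
  by rewrite (canF_eq sK) /s /simple tpermL.
have sr_s z : (s z == sr a) = (z == sl a).
  by rewrite (canF_eq sK) /s /simple tpermR.
have [hyz|] := ltnP (u (s y)) (u (s x)); last by rewrite !andbF.
rewrite !andbT sl_s sr_s -!val_eqE /= !simpleP /bump /= !add1n.
have nslr : ~~ ((x == a :> nat) && (y == a.+1 :> nat)).
  apply/negP => /andP[/eqP ex /eqP eyy].
  have hx : x = sl a by apply: val_inj; rewrite /= ex.
  have hy : y = sr a by apply: val_inj; rewrite /= eyy /bump add1n.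
  move: hyz; rewrite hx hy /s /simple tpermL tpermR => hyz.
  by move: (ltn_trans hyz hd); rewrite ltnn.
have nxy : (x : nat) != y.
  by apply: contraTneq hyz => /val_inj ->; rewrite ltnn.
exact: swap_ltn.
Qed.

Lemma word_perm_rcons a b : word_perm (rcons a b) = compp (word_perm a) (simple b).
Proof.
elim: a => [|c a IH] /=; rewrite /compp; first by rewrite mul1g mulg1.
by rewrite IH /compp mulgA.
Qed.

Lemma reduced_ex u : exists a, reduced u a.
Proof.
move: {2}(plength u) (leqnn (plength u)) => d; elim: d u => [|d IH] u hd.
all: have [/existsP[a ha]|/existsPn hn] :=
  boolP [exists a : 'I_n, (u (sr a) < u (sl a))%N].
- by move: hd; rewrite (plength_descent ha).
- have -> : u = 1%g.
    apply: nodescent => a; rewrite ltn_neqAle leqNgt hn andbT.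
    apply/eqP => /val_inj/perm_inj/(congr1 val)/= /eqP.
    by rewrite /bump /= add1n ltn_eqF.
  exists [::]; rewrite /reduced /= eqxx eq_sym cards_eq0 /=.
  by apply/eqP/setP => p; rewrite !inE !perm1; case: ltngtP.
- have [b /andP[/eqP eb /eqP sb]] : exists b, reduced (compp u (simple a)) b.
    by apply: IH; rewrite -ltnS -plength_descent.
  exists (rcons b a); rewrite /reduced word_perm_rcons eb size_rcons sb.
  by rewrite -plength_descent // eqxx andbT /compp mulgA tperm2 mul1g.
- have -> : u = 1%g.
    apply: nodescent => a; rewrite ltn_neqAle leqNgt hn andbT.
    apply/eqP => /val_inj/perm_inj/(congr1 val)/= /eqP.
    by rewrite /bump /= add1n ltn_eqF.
  exists [::]; rewrite /reduced /= eqxx eq_sym cards_eq0 /=.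
  by apply/eqP/setP => p; rewrite !inE !perm1; case: ltngtP.
Qed.

(* The longest element; see leq_plength_longest and plength_longest_uniq. *)
Definition longest : 'S_n.+1 := perm (@rev_ord_inj n.+1).

Lemma inversions_longest :
  inversions longest = [set p : 'I_n.+1 * 'I_n.+1 | (p.1 < p.2)%N].
Proof.
apply/setP => -[x y]; rewrite !inE /= !permE /=.
by have := ltn_ord x; have := ltn_ord y; lia.
Qed.

Lemma leq_plength_longest u : (plength u <= plength longest)%N.
Proof.
rewrite /plength inversions_longest; apply: subset_leq_card.
by apply/subsetP => p; rewrite !inE => /andP[].
Qed.

Lemma plength_longest_uniq u : plength u = plength longest -> u = longest.
Proof.
move=> e.
have /eqP E : inversions u == inversions longest.
  rewrite eqEcard -/(plength _) -/(plength _) e leqnn andbT inversions_longest.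
  by apply/subsetP => p; rewrite !inE => /andP[].
have H : compp longest u = 1%g.
  apply: nodescent => a; rewrite !comppE !permE /=.
  have : (sl a, sr a) \in inversions u.
    by rewrite E inversions_longest inE /= /bump /= add1n.
  by rewrite inE => /andP[_] /=; have := ltn_ord (u (sl a)); lia.
apply/permP => k; have /permP/(_ k) := H.
rewrite comppE perm1 !permE => h.
by rewrite -[RHS](congr1 (@rev_ord _) h) rev_ordK.
Qed.

End SymmetricGroup.

Section Schubert.
Variable n : nat.
Implicit Types f : {mpoly int[n.+1]}.

Definition divdiff_word (a : seq 'I_n) f : {mpoly int[n.+1]} :=
  foldr (fun b g => divdiff (sl b) (sr b) g) f a.

(* Any reduced word would do: since the divided differences satisfy the braid
   relations, the operator is independent of the choice made by [xchoose]. *)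
Definition divdiff_perm (u : 'S_n.+1) f : {mpoly int[n.+1]} :=
  divdiff_word (xchoose (reduced_ex u)) f.

(* x_1^n x_2^(n-1) ... x_n *)
Definition staircase : {mpoly int[n.+1]} := \prod_(k < n.+1) 'X_k ^+ (n - k).

Definition Schubert (w : 'S_n.+1) : {mpoly int[n.+1]} :=
  divdiff_perm (compp w^-1 (longest n)) staircase.

End Schubert.

(* Main.v *)
Require Import Defs.
From mathcomp Require Import all_boot all_order all_fingroup all_algebra.
From mathcomp Require Import mpoly.
From mathcomp Require Import zify ring.

(* The idea is a transition formula in which only the variable x_j can do harm.
   Let m be the largest non-fixed value of w and r < m its position. Then
     S_w = x_r S_v + sum_q S_{v t_qr},
   where the new permutations fix everything above m and have m further to the
   right; iterating ends at S_1. Since d_ij (x_r f) is x_r' d_ij f + e f with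
   e >= 0 unless r = j, positivity of d_ij S_w follows by induction whenever
   r <> j. If w(j-1) < w(j), then S_w is symmetric in x_{j-1}, x_j and
   d_ij S_w = s_{j-1} d_{i,j-1} S_w (or 0 if i = j-1), so one inducts on j; and
   if w(j-1) > w(j), then r <> j, because r = j would make w(j-1) > m fixed.

   The transition formula is Monk's rule. It comes from the Leibniz rule
     d_u (x_k f) = x_{u(k)} d_u f + sum_{l > k} d_{u t_kl} f - sum_{l < k} d_{u t_kl} f
   (sums over the l for which u covers u t_kl in Bruhat order) applied to f = x^delta. The same
   rule shows that d_u does not depend on the reduced word: the difference E of
   two candidates satisfies E (x_k f) = x_{u(k)} E f and E 1 = 0, so E = 0. *)

Set Implicit Arguments.
Unset Strict Implicit.
Unset Printing Implicit Defensive.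

Import Order.TTheory GRing.Theory Num.Theory.
Local Open Scope ring_scope.

(** * Divided differences *)

Section DividedDifference.
Variables (m : nat) (i j : 'I_m).
Hypothesis ne_ij : i != j.
Implicit Types f g : {mpoly int[m]}.

Lemma msymXU (s : 'S_m) k : msym s 'X_k = 'X_(s k) :> {mpoly int[m]}.
Proof. by rewrite /msym mmapX mmap1U. Qed.

Lemma divdiffD f g : divdiff i j (f + g) = divdiff i j f + divdiff i j g.
Proof.
apply/esym/divdiff_uniq => //.
by rewrite mulrDr !divdiffE msymD opprD addrACA.
Qed.

Lemma divdiffN f : divdiff i j (- f) = - divdiff i j f.
Proof.
by apply/esym/divdiff_uniq => //; rewrite mulrN divdiffE msymN opprD.
Qed.

Lemma divdiff0 : divdiff i j 0 = 0.
Proof. by apply/esym/divdiff_uniq; rewrite // mulr0 msym0 subrr. Qed.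

Lemma divdiffZ c f : divdiff i j (c *: f) = c *: divdiff i j f.
Proof.
by apply/esym/divdiff_uniq => //; rewrite -scalerAr divdiffE msymZ scalerBr.
Qed.

Lemma divdiff_sum I r (P : pred I) (F : I -> {mpoly int[m]}) :
  divdiff i j (\sum_(k <- r | P k) F k) =
  \sum_(k <- r | P k) divdiff i j (F k).
Proof. exact: (big_morph _ divdiffD divdiff0). Qed.

Lemma divdiff_sym f : msym (tperm i j) f = f -> divdiff i j f = 0.
Proof. by move=> e; apply/esym/divdiff_uniq; rewrite // e mulr0 subrr. Qed.

Lemma divdiff_eq0 f : divdiff i j f = 0 -> msym (tperm i j) f = f.
Proof.
by move=> e; apply/esym/subr0_eq; rewrite -divdiffE e mulr0.
Qed.

Lemma msym_divdiff f : msym (tperm i j) (divdiff i j f) = divdiff i j f.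
Proof.
apply: divdiff_uniq => //; apply: oppr_inj.
rewrite -mulNr opprB opprB.
have := congr1 (msym (tperm i j)) (divdiffE i j f).
by rewrite msymM !msymB !msymXU tpermL tpermR -msymMm tperm2 msym1m.
Qed.

Lemma divdiff_divdiff f : divdiff i j (divdiff i j f) = 0.
Proof. exact/divdiff_sym/msym_divdiff. Qed.

Lemma divdiffXM k f : divdiff i j ('X_k * f) =
  'X_(tperm i j k) * divdiff i j f + ((k == i)%:R - (k == j)%:R) * f.
Proof.
apply/esym/divdiff_uniq => //.
rewrite mulrDr mulrCA divdiffE msymM msymXU.
case: tpermP => [->|->|/eqP/negPf -> /eqP/negPf ->].
- by rewrite eqxx (negPf ne_ij) /=; ring.
- by rewrite eqxx eq_sym (negPf ne_ij) /=; ring.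
- by move=> /=; ring.
Qed.

Lemma divdiff1 : divdiff i j 1 = 0.
Proof. by rewrite divdiff_sym ?msym1. Qed.

Lemma mcoeffXUM (k : 'I_m) f (p : 'X_{1..m}) :
  ('X_k * f)@_(U_(k) + p) = f@_p.
Proof. by rewrite mulrC mcoeffMX. Qed.

Lemma mcoeffXUM0 (k : 'I_m) f (p : 'X_{1..m}) : p k = 0%N -> ('X_k * f)@_p = 0.
Proof.
move=> pk; rewrite mcoeffM big1 // => -[x y] /= /eqP e.
rewrite mcoeffX; case: eqP => [ex|]; last by rewrite mul0r.
by have := congr1 (fun z : 'X_{1..m} => z k) e; rewrite pk -ex mnmDE mnm1E eqxx.
Qed.

(* Comparing coefficients in (x_i - x_j) g = f - t_ij f moves a unit of exponent
   from x_j to x_i until x_j is exhausted. *)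
Lemma divdiff_supp f (p : 'X_{1..m}) : (divdiff i j f)@_p != 0 ->
  exists2 q : 'X_{1..m}, f@_q != 0 & mdeg q = (mdeg p).+1 /\
   ((forall k, k != i -> k != j -> q k = p k) /\
    ((p i < q i)%N \/ (p i < q j)%N)).
Proof.
set g := divdiff i j f.
pose sw (q : 'X_{1..m}) := [multinom q (tperm i j k) | k < m].
have [d] := ubnP (p j); elim: d p => // d IH p pd gp.
have e0 : ('X_i * g)@_(U_(i) + p) - ('X_j * g)@_(U_(i) + p) =
   f@_(U_(i) + p) - (msym (tperm i j) f)@_(U_(i) + p).
  by rewrite -!mcoeffB -mulrBl divdiffE.
rewrite mcoeffXUM mcoeff_sym -/(sw _) in e0.
(* Covers both cases in which x_j g has coefficient 0 at x_i x^p: x_j does not occur in x^p, or g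
   has coefficient 0 at the shifted exponent [p']. *)
have base : g@_p = f@_(U_(i) + p) - f@_(sw (U_(i) + p)%MM) ->
  exists2 q : 'X_{1..m}, f@_q != 0 & mdeg q = (mdeg p).+1 /\
   ((forall k, k != i -> k != j -> q k = p k) /\
    ((p i < q i)%N \/ (p i < q j)%N)).
  move=> e; have [f0|f0] := eqVneq (f@_(U_(i) + p)) 0; last first.
    exists (U_(i) + p)%MM => //; split; first by rewrite mdegD mdeg1.
    split=> [k ki kj|]; first by rewrite mnmDE mnm1E eq_sym (negPf ki).
    by left; rewrite mnmDE mnm1E eqxx.
  exists (sw (U_(i) + p)%MM).
    by apply: contraNneq gp => f1; rewrite e f0 f1 subr0.
  split; first by rewrite /sw mdeg_mperm mdegD mdeg1.
  split=> [k ki kj|].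
    by rewrite /sw mnmE tpermD ?mnmDE ?mnm1E 1?eq_sym // (negPf ki).
  by right; rewrite /sw mnmE tpermR mnmDE mnm1E eqxx.
have [pj|pj] := posnP (p j).
  apply: base; rewrite -e0 mcoeffXUM0 ?subr0 //.
  by rewrite mnmDE mnm1E (negPf ne_ij) pj.
pose p' := (U_(i) + (p - U_(j)))%MM.
have Ep : (U_(i) + p = U_(j) + p')%MM.
  apply/mnmP => k; rewrite /p' !mnmDE mnmBE !mnm1E.
  case: (eqVneq j k) => [<-|_] /=; lia.
rewrite Ep mcoeffXUM -Ep in e0.
have [g0|g0] := eqVneq g@_p' 0; first by apply: base; rewrite -e0 g0 subr0.
have [||q fq [dq [qk qi]]] := IH p'.
- rewrite /p' mnmDE mnm1E (negPf ne_ij) mnmBE mnm1E eqxx; lia.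
- by [].
exists q => //; split.
  rewrite dq; have := congr1 (@mdeg _) Ep; rewrite !mdegD !mdeg1; lia.
have p'i : p' i = (p i).+1.
  by rewrite /p' mnmDE mnm1E eqxx mnmBE mnm1E eq_sym (negPf ne_ij) subn0 add1n.
split=> [k ki kj|]; last by move: qi; rewrite p'i; lia.
rewrite qk // /p' mnmDE mnmBE !mnm1E ![_ == k]eq_sym (negPf ki) (negPf kj); lia.
Qed.

End DividedDifference.

(** * Bruhat covers *)

Section Covers.
Variable n : nat.
Implicit Types u v w : 'S_n.+1.

Lemma sl_lt_sr (a : 'I_n) : (sl a < sr a)%N.
Proof. by rewrite /= /bump add1n. Qed.

Lemma sl_neq_sr (a : 'I_n) : sl a != sr a.
Proof. by rewrite -val_eqE /= neq_ltn sl_lt_sr. Qed.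

Lemma val_sr (a : 'I_n) : sr a = (sl a).+1 :> nat.
Proof. by rewrite /= /bump add1n. Qed.

(* Serves instead of the length: it decreases under every transposition that
   removes an inversion, with no condition of covering. *)
Definition disorder u : nat := (\sum_(x < n.+1) x * (n - u x))%N.

(** The drop is (l - k)(u(k) - u(l)). *)
Lemma disorder_tperm u (k l : 'I_n.+1) : (k < l)%N -> (u l < u k)%N ->
  (disorder (tperm k l * u)%g < disorder u)%N.
Proof.
move=> kl ul; have nkl : l != k by rewrite neq_ltn kl orbT.
rewrite /disorder (bigD1 k) // (bigD1 l) //=.
rewrite [X in (_ < X)%N](bigD1 k) // [X in (_ < _ + X)%N](bigD1 l) //=.
rewrite !permM tpermL tpermR !addnA.
rewrite (eq_bigr (fun x : 'I_n.+1 => x * (n - u x)))%N => [|x /andP[xk xl]].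
  rewrite ltn_add2r; have := ltn_ord (u k); have := ltn_ord (u l).
  move: (u k : nat) (u l : nat) (k : nat) (l : nat) kl ul => a b c d; nia.
by rewrite permM tpermD // eq_sym.
Qed.

(** Number-valued functions instead of permutations make the case analysis in [fcovers_swap] plain
    arithmetic. *)
Definition fcovers (f : 'I_n.+1 -> nat) (k l : 'I_n.+1) : bool :=
  [&& (k < l)%N, (f l < f k)%N &
   [forall p : 'I_n.+1, ~~ [&& (k < p)%N, (p < l)%N, (f l < f p)%N & (f p < f k)%N]]].

Lemma fcoversP f (k l : 'I_n.+1) : reflect [/\ (k < l)%N, (f l < f k)%N &
    forall p : 'I_n.+1, ~ [/\ (k < p)%N, (p < l)%N, (f l < f p)%N & (f p < f k)%N]]
  (fcovers f k l).
Proof.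
apply: (iffP and3P) => -[h1 h2 h3]; split=> //.
  by move=> p [a b c d]; move/forallP/(_ p): h3; rewrite a b c d.
by apply/forallP => p; apply/negP => /and4P[a b c d]; apply: (h3 p).
Qed.

(* With mathcomp's product, tperm k l * u is the paper's u t_kl, which has length
   l(u) - 1 exactly when this holds. *)
Definition covers u := fcovers (fun x => u x).

(** No value lies strictly between b and b+1, so exchanging the two alters only the comparison of P
    with Q. The pair (P, Q) itself becomes a cover, and a cover of g is lost exactly when its
    transposition would put b+1 to the left of b. *)
Lemma fcovers_swap (f g : 'I_n.+1 -> nat) b (P Q k l : 'I_n.+1) :
  (P < Q)%N -> f P = b.+1 -> f Q = b -> g P = b -> g Q = b.+1 ->
  (forall p, p != P -> p != Q -> [/\ g p = f p, f p != b & f p != b.+1]) ->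
  fcovers f k l = (fcovers g k l && (tperm k l P < tperm k l Q)%N)
                  || ((k == P) && (l == Q)).
Proof.
move=> PQ fP fQ gP gQ fD.
have key p : [\/ [/\ p = P, f p = b.+1 & g p = b], [/\ p = Q, f p = b & g p = b.+1] |
   [/\ (p != P :> nat), (p != Q :> nat), g p = f p, f p != b & f p != b.+1]].
  have [->|pP] := eqVneq p P; first by constructor 1.
  have [->|pQ] := eqVneq p Q; first by constructor 2.
  by constructor 3; have [] := fD _ pP pQ.
have tE p : nat_of_ord (tperm k l p) = if p == k :> nat then l : nat else
    if p == l :> nat then k : nat else p.
  case: tpermP => [->|->|/eqP h1 /eqP h2]; rewrite ?eqxx //.
    by case: eqP.
  by rewrite !(inj_eq val_inj) (negPf h1) (negPf h2).
rewrite !tE -!val_eqE /= {tE}.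
apply/idP/idP.
- move=> /fcoversP[h1 h2 h3].
  have [/andP[/eqP -> /eqP ->]|nkl] := boolP ((k == P :> nat) && (l == Q :> nat)).
    by rewrite !eqxx orbT.
  rewrite orbF; apply/andP; split.
    apply/fcoversP; split=> //.
      by case: (key k) (key l) => [[? ? ?]|[? ? ?]|[? ? ? ? ?]]
        [[? ? ?]|[? ? ?]|[? ? ? ? ?]]; subst; do ?case: ifP => ?; lia.
    move=> p [h4 h5 h6 h7]; apply: (h3 p); split=> //.
      by case: (key p) (key l) => [[? ? ?]|[? ? ?]|[? ? ? ? ?]]
        [[? ? ?]|[? ? ?]|[? ? ? ? ?]]; subst; do ?case: ifP => ?; lia.
    by case: (key p) (key k) => [[? ? ?]|[? ? ?]|[? ? ? ? ?]]
        [[? ? ?]|[? ? ?]|[? ? ? ? ?]]; subst; do ?case: ifP => ?; lia.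
  (* The betweenness condition at [P] and [Q] decides the cases where exactly one of them is moved
     by the transposition. *)
  have hP : ~~ [&& (k < P)%N, (P < l)%N, (f l < f P)%N & (f P < f k)%N].
    by apply/negP => /and4P[? ? ? ?]; apply: (h3 P).
  have hQ : ~~ [&& (k < Q)%N, (Q < l)%N, (f l < f Q)%N & (f Q < f k)%N].
    by apply/negP => /and4P[? ? ? ?]; apply: (h3 Q).
  by case: (key k) (key l) => [[? ? ?]|[? ? ?]|[? ? ? ? ?]]
        [[? ? ?]|[? ? ?]|[? ? ? ? ?]]; subst; do ?case: ifP => ?; lia.
- case/orP=> [/andP[/fcoversP[h1 h2 h3] h]|/andP[/eqP/val_inj -> /eqP/val_inj ->]]; last first.
    apply/fcoversP; split=> [//||p [? ? ? ?]]; lia.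
  apply/fcoversP; split=> //.
    by move: h; case: (key k) (key l) => [[? ? ?]|[? ? ?]|[? ? ? ? ?]]
        [[? ? ?]|[? ? ?]|[? ? ? ? ?]]; subst; do ?case: ifP => ?; lia.
  move=> p [h4 h5 h6 h7]; apply: (h3 p); split=> //.
    by move: h; case: (key p) (key l) => [[? ? ?]|[? ? ?]|[? ? ? ? ?]]
      [[? ? ?]|[? ? ?]|[? ? ? ? ?]]; subst; do ?case: ifP => ?; lia.
  by move: h; case: (key p) (key k) => [[? ? ?]|[? ? ?]|[? ? ? ? ?]]
      [[? ? ?]|[? ? ?]|[? ? ? ? ?]]; subst; do ?case: ifP => ?; lia.
Qed.

Lemma covers_tperm u (a : 'I_n) (P Q k l : 'I_n.+1) :
  (P < Q)%N -> u P = sr a -> u Q = sl a ->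
  covers u k l = (covers (tperm P Q * u)%g k l && (tperm k l P < tperm k l Q)%N)
                 || ((k == P) && (l == Q)).
Proof.
move=> PQ uP uQ; set u' := (tperm P Q * u)%g.
have uPv : u P = (sl a).+1 :> nat by rewrite uP val_sr.
rewrite /covers; apply: (@fcovers_swap _ _ (sl a)) => //.
- by rewrite uQ.
- by rewrite /u' permM tpermL uQ.
- by rewrite /u' permM tpermR uPv.
- move=> p pP pQ; rewrite /u' permM tpermD 1?eq_sym //; split=> //.
  + by apply: contraNneq pQ => e; apply/eqP/(@perm_inj _ u)/val_inj; rewrite /= -e uQ.
  + by apply: contraNneq pP => e; apply/eqP/(@perm_inj _ u)/val_inj; rewrite /= e uPv.
Qed.

End Covers.

(** * Left descents and reduced words *)

Section Operators.
Variable n : nat.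
Implicit Types (u v w : 'S_n.+1) (a b : 'I_n).
Implicit Types f g : {mpoly int[n.+1]}.

(* u * simple a is the paper's s_a u. *)
Definition ldescent u a : bool := (u^-1%g (sr a) < u^-1%g (sl a))%N.

Lemma ldescentN u a : ~~ ldescent u a = (u^-1%g (sl a) < u^-1%g (sr a))%N.
Proof.
rewrite /ldescent -leqNgt leq_eqVlt orbC; case: ltnP => //= _.
by rewrite (inj_eq val_inj) (inj_eq perm_inj) (negPf (sl_neq_sr a)).
Qed.

Lemma plength_inv u : plength u^-1 = plength u.
Proof.
have le v : (plength v <= plength v^-1)%N.
  rewrite /plength; pose F (p : 'I_n.+1 * 'I_n.+1) := (v p.2, v p.1).
  have F_inj : injective F by move=> [x y] [x' y'] [/perm_inj -> /perm_inj ->].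
  rewrite -(card_imset _ F_inj); apply/subset_leq_card/subsetP.
  by move=> _ /imsetP[[x y] + ->]; rewrite !inE /= !permK andbC.
by apply/eqP; rewrite eqn_leq le andbT -{2}[u]invgK le.
Qed.

Lemma plength_ldescent u a : ldescent u a ->
  plength u = (plength (u * simple a)%g).+1.
Proof.
move=> h; rewrite -plength_inv (plength_descent h) -plength_inv /compp.
by rewrite invMg invgK tpermV.
Qed.

Lemma simpleK a : (simple a * simple a = 1)%g.
Proof. exact: tperm2. Qed.

Lemma mul_simpleK u a : (u * simple a * simple a)%g = u.
Proof. by rewrite -mulgA simpleK mulg1. Qed.

Lemma ldescent_simple u a : ldescent (u * simple a)%g a = ~~ ldescent u a.
Proof.
by rewrite ldescentN /ldescent invMg tpermV !permM tpermL tpermR.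
Qed.

Lemma plength_word (c : seq 'I_n) : (plength (word_perm c) <= size c)%N.
Proof.
elim: c => [|a c IH] /=.
  rewrite leqn0 cards_eq0; apply/eqP/setP => p; rewrite !inE !perm1.
  by case: ltngtP.
rewrite /compp; have [h|h] := boolP (ldescent (word_perm c) a).
  by have := plength_ldescent h; lia.
by rewrite (@plength_ldescent _ a) ?ldescent_simple // mul_simpleK ltnS.
Qed.

(** If a were not a left descent, the tail would spell a permutation of length greater than its
    number of letters. The first letter of a word acts last, so this peels off the outermost divided
    difference. *)
Lemma reduced_cons u a c :
  reduced u (a :: c) = ldescent u a && reduced (u * simple a)%g c.
Proof.
rewrite /reduced /= /compp.
have -> : ((word_perm c * simple a)%g == u) = (word_perm c == (u * simple a)%g).
  by apply/eqP/eqP => [<-|->]; rewrite mul_simpleK.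
have [e|] := eqVneq; rewrite ?andbF //=.
have [h|h] := boolP (ldescent u a).
  by rewrite (plength_ldescent h) eqSS.
have := @plength_ldescent (u * simple a)%g a.
rewrite ldescent_simple h mul_simpleK => /(_ isT) E.
by have := plength_word c; rewrite e; lia.
Qed.

(** Exchanging the values a and a+1 amounts to exchanging their positions P and Q; this is how
    [disorder_tperm] and [covers_tperm] apply to a left descent. *)
Lemma ldescentP u a : ldescent u a ->
  exists P Q : 'I_n.+1, [/\ (P < Q)%N, u P = sr a, u Q = sl a &
    (u * simple a = tperm P Q * u)%g].
Proof.
move=> h; exists (u^-1%g (sr a)), (u^-1%g (sl a)); split; rewrite ?permKV //.
apply/permP => x; rewrite !permM /simple.
case: (tpermP (u^-1%g _)) => [->|->|/eqP h1 /eqP h2].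
- by rewrite !permKV tpermR.
- by rewrite !permKV tpermL.
- by rewrite tpermD // -(inj_eq (@perm_inj _ u^-1%g)) permK eq_sym.
Qed.

Lemma divdiff_word1 (c : seq 'I_n) : divdiff_word c 1 = (c == [::])%:R.
Proof.
elim: c => //= a c ->; case: c => [|b c] /=.
  by rewrite divdiff1 // sl_neq_sr.
by rewrite divdiff0 // sl_neq_sr.
Qed.

End Operators.

(** * The Leibniz rule *)

Section Leibniz.
Variable n : nat.
Implicit Types (u v w : 'S_n.+1) (a b : 'I_n).
Implicit Types f g : {mpoly int[n.+1]}.
Local Notation op := (@divdiff_perm n).
Local Notation dd a := (divdiff (sl a) (sr a)).

Lemma divdiff_wordP (c : seq 'I_n) z f g :
  divdiff_word c (z *: f + g) = z *: divdiff_word c f + divdiff_word c g.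
Proof.
by elim: c => //= a c ->; rewrite divdiffD ?divdiffZ // sl_neq_sr.
Qed.

(** The kernel of [E] is stable under multiplication by every variable and contains 1, hence
    contains all monomials. *)
Lemma twisted_derivation_eq0 u (E : {mpoly int[n.+1]} -> {mpoly int[n.+1]}) :
  (forall z f g, E (z *: f + g) = z *: E f + E g) ->
  (forall k f, E ('X_k * f) = 'X_(u k) * E f) -> E 1 = 0 -> forall f, E f = 0.
Proof.
move=> Elin EX E1.
have E0 : E 0 = 0.
  by have := Elin (-1) 1 1; rewrite !scaleN1r !addNr.
pose K f := forall g, E g = 0 -> E (f * g) = 0.
have KM f g : K f -> K g -> K (f * g).
  by move=> Kf Kg h h0; rewrite -mulrA; apply/Kf/Kg.
have K1 : K 1 by move=> g; rewrite mul1r.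
have KX p : K 'X_[p].
  rewrite mpolyXE_id; apply: big_ind => // k _.
  elim: (p k) => [|d IH]; first by rewrite expr0.
  by rewrite exprS; apply: KM => // g g0; rewrite EX g0 mulr0.
elim/mpolyind => // z p f _ _ IH.
by rewrite Elin IH addr0 -['X_[p]]mulr1 KX // scaler0.
Qed.

(** The operator [D] is a parameter because the rule is first proved for candidates not yet known to
    equal [op u]. *)
Definition Leibniz_rule u (D : {mpoly int[n.+1]} -> {mpoly int[n.+1]}) :=
  forall k f, D ('X_k * f) = 'X_(u k) * D f
    + \sum_(l | covers u k l) op (tperm k l * u)%g f
    - \sum_(l | covers u l k) op (tperm l k * u)%g f.

(** Independence of the reduced word, in the form used by the induction: any left descent may serve
    as the first letter. *)
Definition descent_rule u := forall a f, ldescent u a -> op u f = dd a (op (u * simple a)%g f).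

Lemma divdiff_perm1 f : op 1%g f = f.
Proof.
rewrite /divdiff_perm; case: (xchoose _) (xchooseP (reduced_ex (1 : 'S_n.+1)%g)) => //.
move=> a c /andP[_ /eqP e].
by have := plength_word (n := n) [::]; rewrite /= -e.
Qed.

Lemma divdiff_word_reduced u c f (N : nat) :
  (forall v, (disorder v < N)%N -> descent_rule v) -> (disorder u < N)%N ->
  reduced u c -> divdiff_word c f = op u f.
Proof.
move=> A; elim: c u => [|a c IH] u uN.
  by case/andP=> /eqP <- _; rewrite /= divdiff_perm1.
rewrite reduced_cons => /andP[h r] /=; rewrite (A u uN a f h); congr (dd a _).
apply: IH => //; apply: ltn_trans uN.
by have [P [Q [PQ uP uQ ->]]] := ldescentP h; rewrite disorder_tperm ?uP ?uQ ?sl_lt_sr.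
Qed.

(** A joint induction on [disorder]. Each left descent a of u yields a candidate [G a] for [op u],
    which inherits the Leibniz rule from s_a u. The correction terms do not depend on a, so
    [twisted_derivation_eq0] applies to the difference of two candidates. *)
Lemma divdiff_perm_Leibniz u : descent_rule u /\ Leibniz_rule u (op u).
Proof.
have [N] := ubnP (disorder u); elim: N u => // N IHN u uN.
have {}IHN v : (disorder v < disorder u)%N -> descent_rule v /\ Leibniz_rule v (op v).
  by move=> h; apply: IHN; apply: (leq_trans h); rewrite -ltnS.
have IHA v : (disorder v < disorder u)%N -> descent_rule v by move=> /IHN[].
pose G a f := dd a (op (u * simple a)%g f).
have GL a : ldescent u a -> Leibniz_rule u (G a).
  move=> h k f; have [P [Q [PQ uP uQ eu]]] := ldescentP h.
  rewrite /G; set v := (u * simple a)%g in eu *.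
  have vu : (disorder v < disorder u)%N by rewrite eu disorder_tperm ?uP ?uQ ?sl_lt_sr.
  have vP : v P = sl a by rewrite eu permM tpermL.
  have vQ : v Q = sr a by rewrite eu permM tpermR.
  have cov k' l' : covers u k' l' = covers v k' l' && (tperm k' l' P < tperm k' l' Q)%N
      || ((k' == P) && (l' == Q)) by rewrite eu; apply: covers_tperm PQ uP uQ.
  have covPQ k' l' : (k' == P) && (l' == Q) -> covers v k' l' = false.
    by case/andP=> /eqP-> /eqP->; apply/negbTE/fcoversP => -[_]; rewrite vP vQ val_sr; lia.
  (* If a is an ascent of the smaller permutation [x], applying d_a turns its term into the matching
     term for u; otherwise [op x] already begins with d_a and the term dies. *)
  have step k' l' : covers v k' l' ->
     dd a (op (tperm k' l' * v)%g f) =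
     if (tperm k' l' P < tperm k' l' Q)%N then op (tperm k' l' * u)%g f else 0.
    move=> c; set x := (tperm k' l' * v)%g.
    have xv : (disorder x < disorder v)%N.
      by case/fcoversP: c => ? ? _; apply: disorder_tperm.
    have xdes : ldescent x a = ~~ (tperm k' l' P < tperm k' l' Q)%N.
      apply: negb_inj; rewrite negbK ldescentN /x invMg tpermV !permM.
      by rewrite -vP -vQ !permK.
    case: ifP xdes => tPQ xdes.
      have e : (tperm k' l' * u)%g = (x * simple a)%g by rewrite /x -mulgA mul_simpleK.
      rewrite e [in RHS](IHA _ _ a) ?ldescent_simple ?xdes ?mul_simpleK //.
      rewrite -e; have : covers u k' l' by rewrite cov c tPQ.
      by case/fcoversP => ? ? _; apply: disorder_tperm.
    rewrite (IHA _ _ a) ?xdes //; last exact: ltn_trans xv vu.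
    by rewrite divdiff_divdiff // sl_neq_sr.
  have dsum (R : pred 'I_n.+1) (k' l' : 'I_n.+1 -> 'I_n.+1) :
      (forall l, R l = covers v (k' l) (l' l)) ->
      dd a (\sum_(l | R l) op (tperm (k' l) (l' l) * v)%g f) =
      \sum_(l | covers u (k' l) (l' l) && ~~ ((k' l == P) && (l' l == Q)))
        op (tperm (k' l) (l' l) * u)%g f.
    move=> eR; rewrite divdiff_sum ?sl_neq_sr //.
    rewrite (eq_bigr _ (fun l Rl => step _ _ (etrans (esym (eR l)) Rl))).
    rewrite -big_mkcondr; apply: eq_bigl => l; rewrite eR cov.
    by case: andP (@covPQ (k' l) (l' l)) => [_ -> //|_ _]; rewrite orbF andbT.
  have [_ ->] := IHN _ vu.
  rewrite divdiffD ?divdiffN ?divdiffD ?sl_neq_sr // divdiffXM ?sl_neq_sr //.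
  have /= -> := dsum (fun l => covers v k l) (fun=> k) id (fun=> erefl).
  have /= -> := dsum (fun l => covers v l k) id (fun=> k) (fun=> erefl).
  (* The cover (P, Q) of u has no counterpart for v; its term comes from d_a acting on the variable
     x_{v(k)} alone. *)
  have s1 : \sum_(l | covers u k l && ((k == P) && (l == Q))) op (tperm k l * u)%g f
      = (v k == sl a)%:R * op v f.
    rewrite -vP (inj_eq perm_inj); have [->|_] := eqVneq k P.
      rewrite (big_pred1 Q) ?eu ?mul1r // => l /=.
      by rewrite cov eqxx /= andb_orl; case: (l == Q); rewrite ?andbF ?orbT.
    by rewrite mul0r big_pred0 // => l; rewrite andbF.
  have s2 : \sum_(l | covers u l k && ((l == P) && (k == Q))) op (tperm l k * u)%g f
      = (v k == sr a)%:R * op v f.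
    rewrite -vQ (inj_eq perm_inj); have [->|_] := eqVneq k Q.
      rewrite (big_pred1 P) ?eu ?mul1r // => l /=.
      by rewrite cov eqxx andbT; case: (l == P); rewrite ?andbF ?orbT.
    by rewrite mul0r big_pred0 // => l; rewrite !andbF.
  rewrite [X in _ = _ + X - _](bigID (fun l => (k == P) && (l == Q))) /= s1.
  rewrite [X in _ = _ - X](bigID (fun l => (l == P) && (k == Q))) /= s2.
  rewrite -/(simple a) -permM mul_simpleK; ring.
have Glin a z f g : G a (z *: f + g) = z *: G a f + G a g.
  by rewrite /G /divdiff_perm divdiff_wordP divdiffD ?divdiffZ // sl_neq_sr.
have G1 a : G a 1 = 0.
  rewrite /G /divdiff_perm divdiff_word1; case: (_ == _).
    by rewrite divdiff1 // sl_neq_sr.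
  by rewrite divdiff0 // sl_neq_sr.
have Geq a b f : ldescent u a -> ldescent u b -> G a f = G b f.
  move=> ha hb; apply/subr0_eq; move: f.
  apply: (@twisted_derivation_eq0 u) => [z f g|k f|].
  - by rewrite !Glin scalerBr opprD addrACA.
  - by rewrite (GL a) // (GL b) //; ring.
  - by rewrite !G1 subrr.
have [c ce opE] : exists2 c, reduced u c & forall f, op u f = divdiff_word c f.
  by exists (xchoose (reduced_ex u)) => //; apply: xchooseP.
case: c ce opE => [/andP[/eqP <- _] _|a c].
  split=> [a f|k f]; first by rewrite /ldescent /= invg1 !perm1 val_sr ltnNge leqnSn.
  have c0 k' l' : covers (1%g : 'S_n.+1) k' l' = false.
    by apply/negbTE/fcoversP => -[]; rewrite !perm1; lia.
  by rewrite /= !divdiff_perm1 perm1 !big_pred0 ?subr0 ?addr0 // => l; apply: c0.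
rewrite reduced_cons => /andP[ha rc] opE.
have {}opE f : op u f = G a f.
  rewrite opE /= /G; congr (dd a _); apply: divdiff_word_reduced rc; first exact: IHA.
  by have [P [Q [PQ uP uQ ->]]] := ldescentP ha; rewrite disorder_tperm ?uP ?uQ ?sl_lt_sr.
split=> [b f hb|k f]; first by rewrite opE (Geq a b).
by rewrite opE (GL a) // -opE.
Qed.

End Leibniz.

(** * Monk's rule *)

Section Monk.
Variable n : nat.
Implicit Types (u v w : 'S_n.+1) (a b : 'I_n).
Implicit Types f g : {mpoly int[n.+1]}.
Implicit Types p q : 'X_{1..n.+1}.
Local Notation op := (@divdiff_perm n).
Local Notation dd a := (divdiff (sl a) (sr a)).

Lemma divdiff_perm_ldescent u a f : ldescent u a -> op u f = dd a (op (u * simple a)%g f).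
Proof. by have [h _] := divdiff_perm_Leibniz u; apply: h. Qed.

Lemma divdiff_divdiff_perm u a f :
  dd a (op u f) = if ldescent u a then 0 else op (u * simple a)%g f.
Proof.
case: ifP => h; first by rewrite (divdiff_perm_ldescent _ h) divdiff_divdiff // sl_neq_sr.
by rewrite [RHS](@divdiff_perm_ldescent _ a) ?ldescent_simple ?h // mul_simpleK.
Qed.

(** The span of the divisors of x^delta. What matters later is that the last variable does not occur
    in it. *)
Definition under_staircase f := forall p, f@_p != 0 -> forall k : 'I_n.+1, (p k <= n - k)%N.

(** By [divdiff_supp] the exponent of x_a in d_a f is smaller than some exponent of x_a or x_{a+1}
    in f, so it obeys even the bound for x_{a+1}. Since d_a f is symmetric in the two variables, so
    does the exponent of x_{a+1}. *)
Lemma under_staircase_divdiff a f : under_staircase f -> under_staircase (dd a f).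
Proof.
move=> hf; have nsr := sl_neq_sr a.
have low p : (dd a f)@_p != 0 -> (p (sl a) <= n - a.+1)%N.
  move=> hp; have [q hq [_ [_]]] := divdiff_supp nsr hp.
  by have := hf _ hq (sl a); have := hf _ hq (sr a); rewrite val_sr /=; lia.
move=> p hp k; have [->|ksl] := eqVneq k (sl a).
  by apply: leq_trans (low _ hp) _; rewrite leq_sub2l //=.
have [->|ksr] := eqVneq k (sr a).
  rewrite val_sr; have := low [multinom p (tperm (sl a) (sr a) i) | i < n.+1].
  by rewrite -mcoeff_sym msym_divdiff // mnmE tpermL => /(_ hp).
by have [q hq [_ [qk _]]] := divdiff_supp nsr hp; rewrite -qk //; apply: hf.
Qed.

Lemma staircaseE : staircase n = 'X_[[multinom (n - i)%N | i < n.+1]].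
Proof. by rewrite mpolyXE_id; apply: eq_bigr => i _; rewrite mnmE. Qed.

Lemma under_staircase_perm u : under_staircase (op u (staircase n)).
Proof.
rewrite /divdiff_perm; elim: (xchoose _) => [|a c IH] /=.
  move=> p; rewrite staircaseE mcoeffX; have [<- _ k|_ /eqP//] := eqVneq _ p.
  by rewrite mnmE.
exact: under_staircase_divdiff.
Qed.

Definition homogeneous d f := forall p, f@_p != 0 -> mdeg p = d.

Lemma homogeneous_divdiff_word d (c : seq 'I_n) f :
  homogeneous (size c + d)%N f -> homogeneous d (divdiff_word c f).
Proof.
elim: c d => [|a c IH] d //= hf p hp.
have [q hq [dq _]] := divdiff_supp (sl_neq_sr a) hp.
by apply: succn_inj; rewrite -dq; apply: (IH d.+1) hq; rewrite addnS.
Qed.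

(** The right side is the degree of x^delta. *)
Lemma plength_longest : plength (longest n) = (\sum_(x < n.+1) (n - x))%N.
Proof.
rewrite /plength inversions_longest -sum1_card.
rewrite (eq_bigl (fun p : 'I_n.+1 * 'I_n.+1 => true && (p.1 < p.2)%N));
  last by move=> p; rewrite inE.
rewrite -(pair_big_dep xpredT (fun x y : 'I_n.+1 => (x < y)%N) (fun _ _ => 1%N)) /=.
apply: eq_bigr => x _.
by rewrite -(big_geq_mkord x.+1 n.+1 xpredT (fun=> 1%N)) sum_nat_const_nat muln1 subSS.
Qed.

(** Being killed by every d_a makes f invariant under all permutations, so any variable that occurs
    could be exchanged for the last one. *)
Lemma symmetric_last_free f : (forall a, dd a f = 0) ->
  (forall p, f@_p != 0 -> p ord_max = 0%N) -> forall p, f@_p != 0 -> p = 0%MM.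
Proof.
move=> df f_last.
have fsym s : msym s f = f.
  have [c /andP[/eqP <- _]] := reduced_ex s.
  elim: c => [|a c IH] /=; first exact: msym1m.
  by rewrite /compp msymMm IH (divdiff_eq0 (df a)).
move=> p hp; apply/mnmP => k; rewrite mnm0E.
have := f_last [multinom p (tperm k ord_max i) | i < n.+1].
by rewrite -mcoeff_sym fsym mnmE tpermR; apply.
Qed.

(* The hypothesis says that Monk's rule needs no term outside the symmetric group
   S_{n+1}. All d_a annihilate the polynomial, so it is symmetric; it does not
   contain the last variable and has positive degree, so it is 0. *)
Lemma divdiff_perm_staircase_eq0 u (k l : 'I_n.+1) : (l < k)%N -> (u k < u l)%N ->
  op u ('X_k * staircase n) = 0.
Proof.
move=> lk; have [N] := ubnP (plength (longest n) - plength u).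
elim: N u => // N IH u uN ul.
set F := op u _.
(* Either a is a left descent and d_a F = 0 at once, or d_a F is the same expression for the longer
   permutation s_a u. *)
have dF a : dd a F = 0.
  rewrite divdiff_divdiff_perm; case: ifPn => // h.
  apply: IH.
    have := leq_plength_longest (u * simple a)%g.
    have := @plength_ldescent _ (u * simple a)%g a.
    by rewrite ldescent_simple h mul_simpleK => /(_ isT); lia.
  (* Exchanging the values a and a+1 destroys u(k) < u(l) only if u(k) = a and u(l) = a+1, and then
     a is a left descent because l < k. *)
  have nswap : ~~ ((u k == a :> nat) && (u l == a.+1 :> nat)).
    apply: contra h => /andP[/eqP uk /eqP ulE].
    have {}uk : u k = sl a by apply: val_inj.
    have {}ulE : u l = sr a by apply: val_inj; rewrite /= ulE /bump add1n.
    by rewrite /ldescent -uk -ulE !permK.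
  rewrite !permM !simpleP; move: nswap ul.
  by do ?case: ifP => ?; lia.
(* In the Leibniz expansion the operators applied to x^delta produce no last variable, and x_{u(k)}
   is not the last one because u(k) < u(l). *)
have F_last p : F@_p != 0 -> p ord_max = 0%N.
  have op_last v (q : 'X_{1..n.+1}) : q ord_max != 0%N -> (op v (staircase n))@_q = 0.
    by apply: contraNeq => /under_staircase_perm/(_ ord_max); rewrite subnn leqn0.
  have [//|p_last] := eqVneq (p ord_max) 0%N.
  have sum0 (R : pred 'I_n.+1) (G : 'I_n.+1 -> 'S_n.+1) :
      (\sum_(i | R i) op (G i) (staircase n))@_p = 0.
    by rewrite raddf_sum big1 // => i _; apply: op_last.
  case/negP; rewrite /F; have [_ ->] := divdiff_perm_Leibniz u.
  rewrite mcoeffB mcoeffD !sum0 addr0 subr0; apply/eqP.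
  have [|pk] := posnP (p (u k)); first exact: mcoeffXUM0.
  rewrite -(@submK _ U_(u k) p) ?lep1mP -?lt0n // addmC mcoeffXUM op_last //.
  rewrite mnmBE mnm1E; have [e|_] := eqVneq (u k) ord_max; last by rewrite subn0.
  by have := ltn_ord (u l); rewrite e in ul; move: ul => /=; lia.
have Fhom : homogeneous (plength (longest n) - plength u).+1 F.
  apply: homogeneous_divdiff_word.
  have /andP[_ /eqP ->] := xchooseP (reduced_ex u).
  rewrite addnS subnKC ?leq_plength_longest // plength_longest => p.
  rewrite staircaseE -mpolyXD mcoeffX; have [<- _|_ /eqP//] := eqVneq _ p.
  by rewrite mdegD mdeg1 mdegE add1n; congr _.+1; apply: eq_bigr => i _; rewrite mnmE.
apply/mpolyP => p; rewrite mcoeff0; apply/eqP; apply: contraT => hp.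
by have := Fhom _ hp; rewrite (symmetric_last_free dF F_last hp) mdeg0.
Qed.

(** The definition of a cover is symmetric in positions and values. *)
Lemma covers_inv u (x y : 'I_n.+1) : covers u^-1 (u y) (u x) = covers u x y.
Proof.
apply/fcoversP/fcoversP; rewrite ?permK.
  move=> [h1 h2 h3]; split=> // p [? ? ? ?]; apply: (h3 (u p)).
  by rewrite !permK; split.
move=> [h1 h2 h3]; split=> // p [? ? ? ?]; apply: (h3 (u^-1%g p)).
by rewrite permKV; split=> //.
Qed.

Lemma longestV : (longest n)^-1%g = longest n.
Proof.
by apply/eqP; rewrite eq_invg_mul; apply/eqP/permP => x; rewrite permM !permE /= rev_ordK.
Qed.

Lemma SchubertE w : Schubert w = op (w * longest n)^-1%g (staircase n).
Proof. by rewrite /Schubert /compp invMg longestV. Qed.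

(* The permutation w t_qr has length l(w) + 1 exactly when this holds. *)
Definition climbs w := covers (w * longest n)%g.

Lemma climbsP w (q r : 'I_n.+1) : reflect [/\ (q < r)%N, (w q < w r)%N &
    forall p : 'I_n.+1, ~ [/\ (q < p)%N, (p < r)%N, (w q < w p)%N & (w p < w r)%N]]
  (climbs w q r).
Proof.
have lt x y : ((w * longest n)%g x < (w * longest n)%g y)%N = (w y < w x)%N.
  rewrite !permM !permE /=; have := ltn_ord (w x); have := ltn_ord (w y); lia.
apply: (iffP (fcoversP _ _ _)) => -[h1 h2 h3]; split=> //; rewrite ?lt // -?lt // => p.
  by move=> [? ? ? ?]; apply: (h3 p); rewrite !lt.
by move=> [? ?]; rewrite !lt => ? ?; apply: (h3 p).
Qed.

(** The Leibniz rule for the inverse of [U] = v w_0 at the variable with index [U r], applied to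
    x^delta. Reindexing by [U] turns values into positions and covers into climbs, and the position
    s makes the left side vanish. *)
Lemma Monk v (r s : 'I_n.+1) : (r < s)%N -> (v r < v s)%N ->
  'X_r * Schubert v + \sum_(q | climbs v q r) Schubert (tperm q r * v)%g =
  \sum_(q | climbs v r q) Schubert (tperm r q * v)%g.
Proof.
move=> rs vrs; apply/eqP; rewrite -subr_eq0; apply/eqP.
set U := (v * longest n)%g.
have EU x y : Schubert (tperm x y * v)%g = op (tperm (U x) (U y) * U^-1)%g (staircase n).
  rewrite SchubertE; congr (op _ _).
  by rewrite -mulgA -/U invMg tpermV -tpermJ conjgE mulgA mulgK.
have F0 : op U^-1%g ('X_(U r) * staircase n) = 0.
  apply: (@divdiff_perm_staircase_eq0 _ _ (U s)); rewrite ?permK //.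
  rewrite !permM !permE /=; have := ltn_ord (v s); lia.
rewrite -[RHS]F0; have [_ ->] := divdiff_perm_Leibniz U^-1%g.
rewrite permK SchubertE -/U; congr (_ + _ - _).
  rewrite [RHS](reindex_inj (@perm_inj _ U)) /=; apply: eq_big => q.
    by rewrite covers_inv.
  by move=> _; rewrite EU tpermC.
rewrite [RHS](reindex_inj (@perm_inj _ U)) /=; apply: eq_big => q.
  by rewrite covers_inv.
by move=> _; rewrite EU tpermC.
Qed.

End Monk.

(** * Transition and positivity *)

Section Positivity.
Variable n : nat.
Implicit Types (u v w : 'S_n.+1) (a b : 'I_n).
Implicit Types f g : {mpoly int[n.+1]}.
Local Notation dd a := (divdiff (sl a) (sr a)).

Definition transition w (r : 'I_n.+1) v := Schubert w =
  'X_r * Schubert v + \sum_(q | climbs v q r) Schubert (tperm q r * v)%g.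

Lemma transition_ex w (r : 'I_n.+1) : (r < w r)%N ->
  (forall x : 'I_n.+1, (w r < x)%N -> w x = x) ->
  exists s : 'I_n.+1, [/\ (r < s)%N, (s <= w r)%N & transition w r (tperm r s * w)%g].
Proof.
have [m wr] : exists m, w r = m by exists (w r).
rewrite wr => rm fix_w.
have le_fix x : (m < w x)%N -> w x = x by move/fix_w/perm_inj.
have neq_m x : x != r -> w x != m by rewrite -wr (inj_eq perm_inj).
have wm : (w m < m)%N.
  rewrite ltn_neqAle (inj_eq val_inj) neq_m ?(gtn_eqF rm) 1?leqNgt //=.
    by apply/negP => h; move: (le_fix _ h) (h) => ->; rewrite ltnn.
  by rewrite -val_eqE /= gtn_eqF.
(* The permutation v is obtained by exchanging m with the largest smaller value to its right.
   Position m is a candidate, since w(m) < m. *)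
pose R (x : 'I_n.+1) := (r < x)%N && (w x < m)%N.
have Rm : R m by rewrite /R rm wm.
case: (arg_maxnP (fun x => w x : nat) Rm) => s /andP[rs wsm] smax.
have sm : (s <= m)%N.
  by rewrite leqNgt; apply/negP => h; move: wsm; rewrite fix_w // ltnNge ltnW.
exists s; split=> //; set v := (tperm r s * w)%g.
have vr : v r = w s by rewrite permM tpermL.
have vs : v s = m by rewrite permM tpermR.
have vD x : x != r -> x != s -> v x = w x.
  by move=> xr xs; rewrite permM tpermD // eq_sym.
rewrite /transition (@Monk _ v r s) ?vr ?vs // (big_pred1 s) => [|q].
  by rewrite mulgA tperm2 mul1g.
(* The only climb of v from r to the right is s: another q with w(q) < m contradicts the choice of
   s, and one with w(q) > m is a fixed point beyond s, so s lies in between. *)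
apply/climbsP/eqP => [[rq vq nq]|->]; last first.
  split; rewrite ?vr ?vs // => p [rp ps h1 h2].
  rewrite vD in h1 h2; first last.
  - by rewrite -val_eqE /= ltn_eqF.
  - by rewrite -val_eqE /= gtn_eqF.
  by have := smax p; rewrite /R rp h2 => /(_ isT) /=; rewrite leqNgt h1.
apply/eqP; apply: contraT => qs.
have qr : q != r by rewrite -val_eqE /= gtn_eqF.
rewrite vr (vD q) // in vq.
have [h|h|h] := ltngtP (w q) m.
- by have := smax q; rewrite /R rq h => /(_ isT) /=; rewrite leqNgt vq.
- have qm : (m < q)%N by rewrite -(le_fix _ h).
  case: (nq s); rewrite vr vs (vD q) //; split=> //.
  exact: leq_ltn_trans sm qm.
- by move/val_inj: h => h; have := neq_m q qr; rewrite h eqxx.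
Qed.

(** The outer induction lowers the bound above which all points are fixed, the inner one the
    distance of m from its own place. All permutations of the transition carry m at position s > r,
    since exchanging q < r leaves s alone. *)
Lemma transition_ind (P : 'S_n.+1 -> Prop) : P 1%g ->
  (forall w r v, transition w r v -> (r < w r)%N ->
    (forall x : 'I_n.+1, (w r < x)%N -> w x = x) -> P v ->
    (forall q, climbs v q r -> P (tperm q r * v)%g) -> P w) ->
  forall w, P w.
Proof.
move=> P1 Pstep w.
suff main M v : (forall x : 'I_n.+1, (M <= x)%N -> v x = x) -> P v.
  by apply: (main n.+1) => x; rewrite leqNgt ltn_ord.
elim: M v => [|M IH] v fix_v.
  by rewrite (_ : v = 1%g) //; apply/permP => x; rewrite perm1 fix_v.
have [hM|hM] := leqP n.+1 M.
  by apply: IH => x Mx; have := ltn_ord x; lia.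
pose m := Ordinal hM.
have [N] := ubnP (m - v^-1%g m); elim: N v fix_v => // N IHN v fix_v.
set r := v^-1%g m => rN.
have vr : v r = m by rewrite permKV.
have [rm|mr|/val_inj rm] := ltngtP r m; first last.
- apply: IH => x; rewrite leq_eqVlt => /orP[/eqP e|]; last exact: fix_v.
  by have -> : x = m; [apply: val_inj | rewrite -{1}rm vr].
- by have := fix_v _ mr; rewrite vr => e; move: mr; rewrite -e ltnn.
have rvr : (r < v r)%N by rewrite vr.
have fix_vr (x : 'I_n.+1) : (v r < x)%N -> v x = x by rewrite vr; apply: fix_v.
have [s [rs sm tr]] := transition_ex rvr fix_vr.
rewrite vr in sm.
have xD (x y : 'I_n.+1) : (y <= m)%N -> (m < x)%N -> y != x.
  by move=> ym mx; rewrite -val_eqE /= ltn_eqF // (leq_ltn_trans ym).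
have fix_rs (x : 'I_n.+1) : (m < x)%N -> (tperm r s * v)%g x = x.
  by move=> mx; rewrite permM tpermD ?fix_v // xD // ltnW.
have at_s : (tperm r s * v)%g s = m by rewrite permM tpermR.
have gap : (m - s < N)%N by move: rN rs sm => /=; lia.
apply: Pstep tr _ _ _ _ => //.
  by apply: IHN => //; rewrite (_ : (tperm r s * v)^-1%g m = s) // -at_s permK.
move=> q /climbsP[qr _ _].
apply: IHN => [x mx|].
  rewrite permM tpermD ?fix_rs // xD //; last exact: ltnW.
  by apply: leq_trans (ltnW rm); apply: ltnW.
rewrite (_ : (tperm q r * (tperm r s * v))^-1%g m = s) //.
apply: (@perm_inj _ (tperm q r * (tperm r s * v))%g); rewrite permKV permM tpermD //.
  by rewrite -val_eqE /= ltn_eqF // (ltn_trans qr).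
by rewrite -val_eqE /= ltn_eqF.
Qed.

(** Multiplication by w_0 turns the ascent into a left descent of the index of the operator, so S_w
    lies in the image of d_a. *)
Lemma divdiff_Schubert_ascent w a : (w (sl a) < w (sr a))%N -> dd a (Schubert w) = 0.
Proof.
move=> h; rewrite SchubertE divdiff_divdiff_perm /ldescent invgK !permM !permE /=.
by case: ifPn => //; have := ltn_ord (w (sr a)); lia.
Qed.

Definition nneg_coeffs f := forall p, 0 <= f@_p.

Lemma nneg_coeffsC (c : int) : 0 <= c -> nneg_coeffs c%:MP.
Proof. by move=> c0 p; rewrite mcoeffC mulr_ge0. Qed.

Lemma nneg_coeffsX (k : 'I_n.+1) : nneg_coeffs 'X_k.
Proof. by move=> p; rewrite mcoeffX. Qed.

Lemma nneg_coeffsD f g : nneg_coeffs f -> nneg_coeffs g -> nneg_coeffs (f + g).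
Proof. by move=> f0 g0 p; rewrite mcoeffD addr_ge0. Qed.

Lemma nneg_coeffsM f g : nneg_coeffs f -> nneg_coeffs g -> nneg_coeffs (f * g).
Proof.
by move=> f0 g0 p; rewrite mcoeffM sumr_ge0 // => q _; rewrite mulr_ge0.
Qed.

Lemma nneg_coeffs_sum (I : Type) (r : seq I) (P : pred I) (F : I -> {mpoly int[n.+1]}) :
  (forall i, P i -> nneg_coeffs (F i)) -> nneg_coeffs (\sum_(i <- r | P i) F i).
Proof.
move=> F0; elim/big_ind: _ => //; last exact: nneg_coeffsD.
by move=> p; rewrite mcoeff0.
Qed.

Lemma nneg_coeffs_msym (s : 'S_n.+1) f : nneg_coeffs f -> nneg_coeffs (msym s f).
Proof. by move=> f0 p; rewrite mcoeff_sym. Qed.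

(** Transition writes every S_w as S_1 times a polynomial with nonnegative coefficients. That S_1 is
    a constant c follows from symmetry, and only the sign of c has to be determined. *)
Lemma nneg_Schubert w : nneg_coeffs (Schubert w).
Proof.
pose c := (Schubert (1 : 'S_n.+1)%g)@_0.
have S1 : Schubert (1 : 'S_n.+1)%g = c%:MP.
  apply/mpolyP => p; rewrite mcoeffC; have [->|p0] := eqVneq p 0%MM.
    by rewrite mulr1.
  rewrite mulr0; apply/eqP; apply: contraNT p0 => hp; apply/eqP.
  apply: symmetric_last_free hp => [a|q].
    by apply: divdiff_Schubert_ascent; rewrite !perm1 sl_lt_sr.
  by rewrite SchubertE => /under_staircase_perm/(_ ord_max); rewrite subnn leqn0 => /eqP.
have cS w' : exists2 g, nneg_coeffs g & Schubert w' = c *: g.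
  elim/transition_ind: w' => [|w' r v -> _ _ [gv gv0 ->] IH].
    by exists 1; [apply: nneg_coeffsC | rewrite S1 -mul_mpolyC mulr1].
  have [g g0 ->] : exists2 g, nneg_coeffs g &
      \sum_(q | climbs v q r) Schubert (tperm q r * v)%g = c *: g.
    elim/big_ind: _ => [|_ _ [g1 g10 ->] [g2 g20 ->]|q /IH //].
      by exists 0; rewrite ?scaler0 // => p; rewrite mcoeff0.
    by exists (g1 + g2); [apply: nneg_coeffsD | rewrite scalerDr].
  exists ('X_r * gv + g); last by rewrite scalerDr scalerAr.
  by apply: nneg_coeffsD => //; apply: nneg_coeffsM => //; apply: nneg_coeffsX.
(* The coefficient of x^delta in S_{w0} = x^delta is 1 and a multiple of c. *)
have c0 : 0 <= c.
  have [g g0] := cS (longest n).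
  have -> : Schubert (longest n) = staircase n.
    by rewrite SchubertE -{1}longestV mulVg invg1 divdiff_perm1.
  rewrite staircaseE => /(congr1 (mcoeff [multinom (n - i)%N | i < n.+1])).
  rewrite mcoeffX eqxx mcoeffZ; have := g0 [multinom (n - i)%N | i < n.+1].
  by move: (g@__) => z; nia.
have [g g0 ->] := cS w.
by move=> p; rewrite mcoeffZ mulr_ge0.
Qed.

(** Conjugation by s_a carries t_{i,a} to t_{i,a+1} and fixes f. *)
Lemma divdiff_adjacent (i : 'I_n.+1) a f : i != sl a -> i != sr a ->
  msym (simple a) f = f ->
  divdiff i (sr a) f = msym (simple a) (divdiff i (sl a) f).
Proof.
move=> il ir fsym; apply/esym/divdiff_uniq => //.
have := congr1 (msym (simple a)) (divdiffE i (sl a) f).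
rewrite msymM !msymB !msymXU /simple tpermL tpermD 1?eq_sym // => ->.
rewrite -!/(simple a) fsym; congr (_ - _).
rewrite -{1}fsym -!msymMm; congr (msym _ _).
by rewrite -{1}[simple a]tpermV -conjgE tpermJ /simple tpermL tpermD // eq_sym.
Qed.

Lemma nneg_divdiff_Schubert (i j : 'I_n.+1) w : (i < j)%N ->
  nneg_coeffs (divdiff i j (Schubert w)).
Proof.
have [N] := ubnP j; elim: N i j w => // N IH i j w jN ij.
have [a ja] : exists a, j = sr a.
  have hj : (j.-1 < n)%N by have := ltn_ord j; lia.
  by exists (Ordinal hj); apply: val_inj; rewrite /= /bump add1n; lia.
have ne_ij : i != j by rewrite -val_eqE /= ltn_eqF.
have asc v : (v (sl a) < v (sr a))%N -> nneg_coeffs (divdiff i j (Schubert v)).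
  move=> h; have da := divdiff_Schubert_ascent h.
  have [ia|ia] := eqVneq i (sl a).
    by rewrite ia ja da => p; rewrite mcoeff0.
  rewrite ja divdiff_adjacent -?ja //; last exact: divdiff_eq0.
  apply: nneg_coeffs_msym; apply: IH; first by move: jN; rewrite ja val_sr.
  by move: ij; rewrite ja val_sr ltnS leq_eqVlt (inj_eq val_inj) (negPf ia).
elim/transition_ind: w => [|w r v tr rwr fix_w IHv IHq].
  by apply: asc; rewrite !perm1 sl_lt_sr.
have [/asc //|] := ltnP (w (sl a)) (w (sr a)).
rewrite leq_eqVlt (inj_eq val_inj) (inj_eq perm_inj) eq_sym (negPf (sl_neq_sr a)) /=.
(* If r = j, then w(j-1) > w(r) forces w(j-1) = j-1, hence w(r) < j-1 < r, against r < w(r). *)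
move=> des; have rj : r != j.
  apply: contraTneq rwr => rE; rewrite rE ja in fix_w *.
  have /perm_inj e := fix_w _ des.
  by move: des; rewrite e -leqNgt => /ltn_trans/(_ (sl_lt_sr a))/ltnW.
(* With r different from j the constant of [divdiffXM] is 0 or 1, so no negative term remains. *)
rewrite tr divdiffD // divdiff_sum // divdiffXM // (negPf rj) subr0.
apply: nneg_coeffsD; last by apply: nneg_coeffs_sum => q /IHq.
apply: nneg_coeffsD; apply: nneg_coeffsM => //; first exact: nneg_coeffsX.
  by rewrite -mpolyC_nat; apply: nneg_coeffsC.
exact: nneg_Schubert.
Qed.

End Positivity.

Unset Implicit Arguments.

Theorem theorem1 (n : nat) (hn : (1 <= n)%N) (i j : 'I_n.+1) (hij : (i < j)%N)
    (w : 'S_n.+1) :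
  divdiff i j (Schubert w) \is a mpolyOver n.+1 Num.nat.
Proof.
apply/mpolyOverP => p.
have := nneg_divdiff_Schubert w hij p.
by case: (_@__) => // k _; apply/natrP; exists k; rewrite natz.
Qed.
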